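(* Let $n$ and $k$ be integers with $1\le k\le n$, and let $\wedge:(\mathbb{R}^n)^k\to\mathbb{R}^{\binom{n}{k}}$ be the exterior product function defined in the context. For $u_1,\dots,u_k\in\mathbb{R}^n$ let $U$ denote the $k\times n$ matrix with rows $u_1,\dots,u_k$, and write $\wedge(U)=\wedge(u_1,\dots,u_k)$. Then: 1) If $k=n$, then $\wedge(U)=\det(U)$ (identifying $\mathbb{R}^1$ with $\mathbb{R}$, $e_1=1$). 2) If $k=n-1$, then $\wedge$ is the generalized vector product, i.e. $\wedge(u_1,\dots,u_{n-1})=\times(u_1,\dots,u_{n-1})$ for all $u_1,\dots,u_{n-1}\in\mathbb{R}^n$. 3) If $n$ is even and $k=1$, then $U$ is orthogonal to $\wedge(U)$, with respect to the standard scalar product of $\mathbb{R}^n$. 4) $\wedge$ is $k$-linear, i.e. linear in each of its $k$ arguments when the others are fixed; in particular $\wedge(u_1,\dots,u_i+b,\dots,u_k)=\wedge(u_1,\dots,u_i,\dots,u_k)+\wedge(u_1,\dots,b,\dots,u_k)$ for all $1\le i\le k$ and $b\in\mathbb{R}^n$. 5) If $M$ is a real $k\times n$ matrix and $M_p$ is obtained from $M$ by interchanging two rows (the other rows being fixed), then $\wedge(M_p)=-\wedge(M)$. 6) If $u_1,\dots,u_k$ are linearly dependent vectors of $\mathbb{R}^n$, then $\wedge(u_1,\dots,u_k)=0\in\mathbb{R}^{\binom{n}{k}}$.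
   Context: Let $I=\{i_1i_2\cdots i_k : 1\le i_1<i_2<\cdots<i_k\le n\}$ be the set of strictly increasing index strings of length $k$, ordered lexicographically; it has $\binom{n}{k}$ elements. For $i\in I$, the rank $r(i)\in\{1,\dots,\binom{n}{k}\}$ is the position of $i$ in $I$ in the (increasing) lexicographic order. For a real $k\times n$ matrix $U$ and $i=i_1\cdots i_k\in I$, $U_i$ is the $k\times k$ matrix formed by the columns $i_1,\dots,i_k$ of $U$. The exterior product is $$\wedge(U)=\sum_{i\in I}(-1)^{\binom{n}{k}-r(i)}\det(U_i)\,e_{\binom{n}{k}-r(i)+1},$$ where $e_j$ is the $j$-th vector of the standard basis of $\mathbb{R}^{\binom{n}{k}}$. The generalized vector product $\times:(\mathbb{R}^n)^{n-1}\to\mathbb{R}^n$ is $$\times(A_1,\dots,A_{n-1})=\sum_{j=1}^n(-1)^{1+j}\det(X_j)\,e_j,$$ where $e_j$ is the $j$-th standard basis vector of $\mathbb{R}^n$ and $X_j$ is the $(n-1)\times(n-1)$ matrix obtained by deleting the $j$-th column of the $(n-1)\times n$ matrix with rows $A_1,\dots,A_{n-1}$. *)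

(* Defs.v *)
From HB Require Import structures.
From mathcomp Require Import all_boot all_order all_algebra.
From mathcomp Require Import reals.

Set Implicit Arguments.
Unset Strict Implicit.
Unset Printing Implicit Defensive.

Import Order.TTheory GRing.Theory Num.Theory.
Local Open Scope ring_scope.

(* Columns are numbered from 0, by 'I_n; this affects neither the
   lexicographic order nor the ranks. *)
Definition index_strings (n k : nat) : {set k.-tuple 'I_n} :=
  [set i : k.-tuple 'I_n | sorted ltn [seq val x | x <- i]].

Lemma card_index_strings (n k : nat) : #|index_strings n k| = 'C(n, k).
Proof. exact: card_ltn_sorted_tuples. Qed.

(* The position of i, counted from 1: the number of strings j with j <= i. *)
Definition lex_rank (n k : nat) (i : k.-tuple 'I_n) : nat :=
  #|[set j in index_strings n k |
      ((j : k.-tuplelexi 'I_n) <= (i : k.-tuplelexi 'I_n))%O]|.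

(* Hence 'C(n, k) - lex_rank i below is not truncated, and
   'C(n, k) - lex_rank i + 1 lies between 1 and 'C(n, k). *)
Lemma lex_rank_bounds (n k : nat) (i : k.-tuple 'I_n) :
  i \in index_strings n k -> (1 <= lex_rank i <= 'C(n, k))%N.
Proof.
move=> iI; apply/andP; split.
  by apply/card_gt0P; exists i; rewrite inE iI lexx.
by rewrite -card_index_strings; apply/subset_leq_card/subsetP=> j /setIdP[].
Qed.

(* The standard basis e_1, ..., e_N of R^N, numbered from 1. *)
Definition std_basis (R : realType) (N j : nat) : 'rV[R]_N :=
  \row_(l < N) (l.+1 == j)%:R.

Definition column_minor (R : realType) (k n : nat) (U : 'M[R]_(k, n))
    (i : k.-tuple 'I_n) : 'M[R]_k :=
  colsub (tnth i) U.

Definition wedge (R : realType) (k n : nat) (U : 'M[R]_(k, n)) :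
    'rV[R]_('C(n, k)) :=
  \sum_(i in index_strings n k)
    ((-1) ^+ ('C(n, k) - lex_rank i) * \det (column_minor U i))
      *: std_basis R 'C(n, k) ('C(n, k) - lex_rank i + 1).

Definition wedge_vec (R : realType) (k n : nat) (u : 'I_k -> 'rV[R]_n) :
    'rV[R]_('C(n, k)) :=
  wedge (\matrix_(i < k) u i).

(* j runs over 'I_n, so the 1-based index is j.+1. *)
Definition gen_vector_product (R : realType) (n : nat)
    (A : 'I_n.-1 -> 'rV[R]_n) : 'rV[R]_n :=
  \sum_(j < n)
    ((-1) ^+ (1 + j.+1) * \det (col' j (\matrix_(i < n.-1) A i)))
      *: std_basis R n j.+1.

Definition dot (R : realType) (n : nat) (u v : 'rV[R]_n) : R :=
  \sum_(j < n) u 0 j * v 0 j.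

Definition replace_vec (R : realType) (k n : nat) (u : 'I_k -> 'rV[R]_n)
    (i : 'I_k) (x : 'rV[R]_n) : 'I_k -> 'rV[R]_n :=
  fun j => if j == i then x else u j.

Lemma bin_pred (n : nat) : (0 < n)%N -> 'C(n, n.-1) = n.
Proof. by case: n => // n _; rewrite binSn. Qed.

(* Main.v *)
Require Import Defs.
From HB Require Import structures.
From mathcomp Require Import all_boot all_order all_algebra.
From mathcomp Require Import reals zify.

Set Implicit Arguments.
Unset Strict Implicit.
Unset Printing Implicit Defensive.

Import Order.TTheory GRing.Theory Num.Theory.
Local Open Scope ring_scope.

(** The coordinates of [wedge U] are, up to sign, the maximal minors of [U]; the
    work lies in knowing which minor stands where.  An enumeration of the index
    strings in decreasing lexicographic order settles this at once: the string
    in position [l], counted from 0, has rank ['C(n, k) - l], so that it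
    contributes to coordinate [l] and with sign [(-1) ^+ l] ([wedge_enum]).  In
    the three special cases such an enumeration is explicit:
    - [k = n]: there is one string, and its minor is [\det U];
    - [k = n - 1]: coordinate [j] belongs to the string that omits [j], since
      omitting a later index gives a smaller string; this is the vector product;
    - [k = 1]: coordinate [j] belongs to the letter [rev_ord j], so that
      [wedge U] is [U] reversed with alternating signs.  For even [n] the
      indices [j] and [rev_ord j] have opposite parities, so the terms of the
      scalar product at [j] and [rev_ord j] cancel.

    Linearity in each row, antisymmetry and vanishing on dependent rows hold
    for each minor separately.  Selecting columns keeps the rows aligned, and it
    commutes with multiplication on the left, so an exchange of rows or a linear
    relation between the rows of [U] passes to every minor. *)

(** * Coordinates of the exterior product *)

Lemma mktuple_index_string (n k : nat) (g : 'I_k -> 'I_n) :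
  (forall a b : 'I_k, (a < b)%N -> (g a < g b)%N) ->
  [tuple g i | i < k] \in index_strings n k.
Proof.
move=> g_mono; rewrite inE /= -map_comp sorted_map.
apply: (@sub_sorted _ (relpre val ltn)) => [a b /g_mono //|].
by rewrite -sorted_map val_enum_ord iota_ltn_sorted.
Qed.

(** The three hypotheses on [f] make it the full list of the index strings in
    decreasing order: it is injective by strict monotonicity, and exhaustive by
    cardinality. *)
Section Enum.
Variables (n k N : nat) (f : 'I_N -> k.-tuple 'I_n).
Hypothesis eN : 'C(n, k) = N.
Hypothesis fI : forall l, f l \in index_strings n k.
Hypothesis f_anti : forall l m : 'I_N, (l < m)%N ->
  ((f m : k.-tuplelexi 'I_n) < (f l : k.-tuplelexi 'I_n))%O.

Lemma enum_inj : injective f.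
Proof.
move=> l m elm; apply/val_inj/eqP; rewrite eqn_leq.
by apply/andP; split; rewrite leqNgt; apply/negP=> /f_anti; rewrite elm ltxx.
Qed.

Lemma enum_image : index_strings n k = [set f l | l : 'I_N].
Proof.
apply/eqP; rewrite eq_sym eqEcard; apply/andP; split.
  by apply/subsetP=> _ /imsetP[l _ ->].
by rewrite card_index_strings card_imset ?card_ord ?eN //; exact: enum_inj.
Qed.

(** The strings up to [f l] are the [f m] with [l <= m < N]. *)
Lemma enum_lex_rank (l : 'I_N) : lex_rank (f l) = (N - l)%N.
Proof.
have f_le m : ((f m : k.-tuplelexi 'I_n) <= (f l : k.-tuplelexi 'I_n))%O
    = (l <= m)%N.
  case: (ltngtP l m) => [/f_anti/ltW->//|/f_anti|/val_inj->]; last exact: lexx.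
  by rewrite ltNge => /negPf.
rewrite /lex_rank enum_image.
have -> : [set j in [set f m | m : 'I_N] |
    ((j : k.-tuplelexi 'I_n) <= (f l : k.-tuplelexi 'I_n))%O]
    = [set f m | m : 'I_N & (l <= m)%N].
  apply/setP=> j; rewrite inE; apply/andP/imsetP.
    by case=> /imsetP[m _ ->]; rewrite f_le => lm; exists m; rewrite ?inE.
  by case=> m; rewrite inE -f_le => fm ->; split; rewrite // imset_f.
rewrite card_imset; last exact: enum_inj.
by rewrite -sum1dep_card -(big_geq_mkord _ _ xpredT (fun=> 1%N))
  sum_nat_const_nat muln1.
Qed.

(** The rank [N - l] turns the exponent [N - r] into [l] and the 1-based
    position [N - r + 1] into [l.+1]. *)
Lemma wedge_enum (R : realType) (U : 'M[R]_(k, n)) (l : 'I_N) :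
  castmx (erefl 1%N, eN) (wedge U) 0 l
  = (-1) ^+ l * \det (column_minor U (f l)).
Proof.
rewrite castmxE /wedge enum_image big_imset /=;
  last by move=> ? ? _ _ /enum_inj.
rewrite summxE (bigD1 l) //= big1 ?addr0 => [|m ml];
  rewrite !mxE enum_lex_rank /= eN subKn 1?ltnW// addn1 /= eqSS.
  by rewrite eqxx mulr1.
by rewrite eq_sym val_eqE (negPf ml) mulr0.
Qed.
End Enum.

(** * The cases k = n, k = n - 1 and k = 1 *)

Lemma wedge_full (R : realType) (n : nat) (U : 'M[R]_(n, n)) :
  castmx (erefl 1%N, binn n) (wedge U) = (\det U)%:M.
Proof.
apply/matrixP=> i l; rewrite !ord1.
rewrite (@wedge_enum n n 1 (fun=> [tuple i | i < n])).
- rewrite expr0 mul1r mxE eqxx mulr1n; congr (\det _).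
  by apply/matrixP=> a b; rewrite mxE tnth_mktuple.
- by move=> _; apply: mktuple_index_string.
- by move=> a b; rewrite !ord1.
Qed.

Lemma wedge_codim1 (R : realType) (n : nat) (e : 'C(n, n.-1) = n)
    (U : 'M[R]_(n.-1, n)) (j : 'I_n) :
  castmx (erefl 1%N, e) (wedge U) 0 j = (-1) ^+ j * \det (col' j U).
Proof.
rewrite (@wedge_enum n n.-1 n (fun j => [tuple lift j i | i < n.-1])).
- congr (_ * \det _); apply/matrixP=> a b; rewrite !mxE.
  by rewrite tnth_mktuple.
- move=> l; apply: mktuple_index_string => a b /=.
  by rewrite /bump; case: leqP; case: leqP; lia.
- move=> l m lm; apply/ltxi_tuplePlt.
  (* Strings l < m agree before position l, where m has l and l has l + 1. *)
  have ln : (l < n.-1)%N by have := ltn_ord m; lia.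
  exists (Ordinal ln) => [i|].
    rewrite /= => il; rewrite !tnth_mktuple; apply: val_inj.
    by rewrite /= /bump leqNgt (ltn_trans il lm) leqNgt il.
  by rewrite !tnth_mktuple ltEord /= /bump leqnn (leqNgt m) lm.
Qed.

Lemma wedge_vector_product (R : realType) (n : nat) (e : 'C(n, n.-1) = n)
    (u : 'I_n.-1 -> 'rV[R]_n) :
  castmx (erefl 1%N, e) (wedge_vec u) = gen_vector_product u.
Proof.
apply/rowP=> j; rewrite wedge_codim1 /gen_vector_product summxE (bigD1 j) //=.
rewrite big1 ?addr0 => [|i ij]; rewrite !mxE eqSS.
  by rewrite eqxx mulr1 !exprS mulrA mulrNN !mul1r.
by rewrite val_eqE eq_sym (negPf ij) mulr0.
Qed.

Lemma wedge_one (R : realType) (n : nat) (U : 'M[R]_(1, n)) (j : 'I_n) :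
  castmx (erefl 1%N, bin1 n) (wedge U) 0 j = (-1) ^+ j * U 0 (rev_ord j).
Proof.
rewrite (@wedge_enum n 1 n (fun j => [tuple rev_ord j])).
- by rewrite det_mx11 !mxE.
- by move=> l; rewrite inE.
- move=> l m lm; apply/ltxi_tuplePlt; exists ord0 => [i|]; first by rewrite ord1.
  by rewrite !(tnth_nth l) /= ltEord /=; have := ltn_ord m; lia.
Qed.

Lemma wedge_one_orthogonal (R : realType) (n : nat) (U : 'M[R]_(1, n)) :
  ~~ odd n -> dot U (castmx (erefl 1%N, bin1 n) (wedge U)) = 0.
Proof.
move=> n_even; set d := dot _ _.
(* Reindexing the sum by rev_ord reverses the sign of every term. *)
suff: d = - d by move/eqP; rewrite -addr_eq0 -mulr2n mulrn_eq0 => /eqP.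
rewrite {1}/d /d /dot -sumrN (reindex_inj rev_ord_inj) /=; apply: eq_bigr => j _.
rewrite !wedge_one rev_ordK.
have -> : (-1) ^+ rev_ord j = - (-1) ^+ j :> R.
  rewrite -signr_odd /= oddB ?ltn_ord // (negPf n_even) /=.
  by rewrite signrN signr_odd.
by rewrite mulNr mulrN mulrCA [in RHS]mulrCA [U 0 j * _]mulrC.
Qed.

(** * Multilinearity, antisymmetry and dependent rows *)

Lemma wedge_vec_linear (R : realType) (k n : nat) (u : 'I_k -> 'rV[R]_n) i :
  linear (fun x => wedge_vec (replace_vec u i x)).
Proof.
move=> a x y; rewrite /wedge_vec /wedge scaler_sumr -big_split /=.
apply: eq_bigr => s _; rewrite scalerA -scalerDl; congr (_ *: _).
rewrite mulrCA -mulrDr; congr (_ * _).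
rewrite -[\det (column_minor (\matrix_j replace_vec u i y j) s)]mul1r.
apply: (determinant_multilinear (i0 := i)).
- by apply/rowP=> j; rewrite !mxE /replace_vec eqxx mul1r !mxE.
- by apply/matrixP=> b c; rewrite !mxE /replace_vec eq_sym (negPf (neq_lift _ _)).
- by apply/matrixP=> b c; rewrite !mxE /replace_vec eq_sym (negPf (neq_lift _ _)).
Qed.

Lemma wedge_xrow (R : realType) (k n : nat) (M : 'M[R]_(k, n)) (i1 i2 : 'I_k) :
  i1 != i2 -> wedge (xrow i1 i2 M) = - wedge M.
Proof.
move=> i12; rewrite /wedge -sumrN; apply: eq_bigr => s _.
rewrite /column_minor xrowE -mulmx_colsub det_mulmx det_perm.
by rewrite perm.odd_tperm i12 mulN1r mulrN scaleNr.
Qed.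

(** A nonzero row [v] with [v *m U = 0] also annihilates every column selection
    of [U], so that every minor is singular. *)
Lemma wedge_dependent (R : realType) (k n : nat) (u : 'I_k -> 'rV[R]_n) :
  ~~ free [tuple u i | i < k] -> wedge_vec u = 0.
Proof.
move=> u_dep; rewrite /wedge_vec /wedge big1 // => s _.
suff [v v0 vU] : exists2 v : 'rV[R]_k, v != 0 & v *m (\matrix_i u i) = 0.
  suff -> : \det (column_minor (\matrix_i u i) s) = 0 by rewrite mulr0 scale0r.
  apply/eqP/det0P; exists v => //; rewrite mulmx_colsub vU.
  by apply/matrixP=> a b; rewrite !mxE.
have: ~~ row_free (\matrix_i u i).
  apply: contra u_dep => U_free; apply/freeP=> c cu0 i.
  have /(row_free_inj U_free)/rowP/(_ i) :
      (\row_j c j) *m (\matrix_i u i) = 0 *m (\matrix_i u i).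
    rewrite mul0mx mulmx_sum_row -[RHS]cu0; apply: eq_bigr => j _.
    by rewrite rowK mxE -tnth_nth tnth_mktuple.
  by rewrite !mxE.
by rewrite -kermx_eq0 => /rowV0Pn[v /sub_kermxP vU v0]; exists v.
Qed.

Theorem mainTheorem1 (R : realType) (n k : nat)
    (hk : (1 <= k)%N) (hkn : (k <= n)%N) :
  (* 1 *)
  (k = n -> forall U : 'M[R]_(n, n),
     castmx (erefl 1%N, binn n) (wedge U) = (\det U)%:M) /\
  (* 2 *)
  (k = n.-1 -> forall u : 'I_n.-1 -> 'rV[R]_n,
     castmx (erefl 1%N, bin_pred (leq_trans hk hkn)) (wedge_vec u)
     = gen_vector_product u) /\
  (* 3 *)
  (~~ odd n -> k = 1%N -> forall U : 'M[R]_(1, n),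
     dot U (castmx (erefl 1%N, bin1 n) (wedge U)) = 0) /\
  (* 4 *)
  ((forall (u : 'I_k -> 'rV[R]_n) (i : 'I_k),
      linear (fun x : 'rV[R]_n => wedge_vec (replace_vec u i x))) /\
   (forall (u : 'I_k -> 'rV[R]_n) (i : 'I_k) (b : 'rV[R]_n),
      wedge_vec (replace_vec u i (u i + b))
      = wedge_vec u + wedge_vec (replace_vec u i b))) /\
  (* 5 *)
  (forall (M : 'M[R]_(k, n)) (i1 i2 : 'I_k), i1 != i2 ->
     wedge (xrow i1 i2 M) = - wedge M) /\
  (* 6 *)
  (forall u : 'I_k -> 'rV[R]_n,
     ~~ free [tuple u i | i < k] -> wedge_vec u = 0).
Proof.
split; first by move=> _ U; exact: wedge_full.
split; first by move=> _ u; exact: wedge_vector_product.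
split; first by move=> n_even _ U; exact: wedge_one_orthogonal.
split; last by split; [exact: wedge_xrow | exact: wedge_dependent].
split; first exact: wedge_vec_linear.
move=> u i b; have := wedge_vec_linear u i 1 (u i) b; rewrite !scale1r => ->.
congr (wedge _ + _); apply/matrixP=> j l; rewrite !mxE /replace_vec.
by case: eqP => [->|].
Qed.
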